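(* Let $H$ be a finitely generated amenable group. Let $\mathscr{L}H$ be a naturally generated and large-scale commutative halo product over $H$ having consistent blocks. Then, given a real number $p\ge 1$, there is a constant $C>0$ such that the $\ell^p$-isoperimetric profile of $\mathscr{L}H$ satisfies $$\frac1C\, j_{p,H}\left(\frac1C\varphi^{-1}(x)\right)\le j_{p,\mathscr{L}H}(x)\le C\, j_{1,H}(C\ln x)$$ for all sufficiently large $x$, where $\varphi(x)=x\cdot\Lambda_{\mathscr{L}H}(x)$ and $\Lambda_{\mathscr{L}H}$ is the lamp growth sequence of $\mathscr{L}H$.
   Context: Halo products: a halo of groups $\mathscr{L}$ over a set $X$ is the data, for each subset $S\subset X$, of a group $L(S)$ such that: $R\subset S$ implies $L(R)\leqslant L(S)$; $L(\emptyset)=\{1\}$ and $L(X)=\langle L(S): S\subset X\text{ finite}\rangle$; $L(R\cap S)=L(R)\cap L(S)$ for all $R,S\subset X$. Here $X=H$ with $H$ acting on itself by left multiplication; given a morphism $\alpha\colon H\to\mathrm{Aut}(L(H))$ with $\alpha(h)(L(S))=L(hS)$ for all $h\in H$, $S\subset H$, the halo product is $\mathscr{L}H=L(H)\rtimes_\alpha H$. Properties, with $S_H$ a fixed finite generating set of $H$ and $d_{S_H}$ its word metric: - $\mathscr{L}H$ is naturally generated if it is generated by $\{(1_{L(H)},s): s\in S_H\}\cup\bigcup_{s\in S_H}\{(\sigma,1_H):\sigma\in L(\{1_H,s\})\}$. - $\mathscr{L}H$ is large-scale commutative if there is $D\ge 0$ such that for all $R,S\subset H$ with $d_{S_H}(R,S)\ge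 D$, the subgroups $L(R)$ and $L(S)$ commute in $L(H)$. - $\mathscr{L}H$ has consistent blocks if $L(S)$ is finite for every finite $S\subset H$ and its cardinality depends only on $|S|$. The lamp growth sequence is then $\Lambda_{\mathscr{L}H}(n)=|L(S)|$ for any $S\subset H$ with $|S|=n$. $\varphi$ is increasing and $\varphi^{-1}$ denotes its (generalised) inverse. Isoperimetric profile: for a finitely generated group $G$ with finite generating set $S_G$ and a real $p\ge 1$, $j_{p,G}(x)=\sup \|f\|_p/\|\nabla f\|_p$, the supremum being over (nonzero) functions $f\colon G\to\mathbb{R}_+$ with $|\mathrm{supp}\, f|\le x$, where $\|\nabla f\|_p^p=\sum_{g\in G,\,s\in S_G}|f(g)-f(gs)|^p$. Profiles are considered up to asymptotic equivalence (where non-decreasing $f,g$ are asymptotically equivalent if there is $C>0$ with $f(x)=O(g(Cx))$ and $g(x)=O(f(Cx))$ as $x\to+\infty$); in particular the choice of $S_G$ is irrelevant.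
   Formalization: L(H) is assumed to be a nontrivial group; for the trivial halo L(S)={1} over H=Z one has LH=Z, and the upper bound would read x ≤ C ln x up to constants, which is false. *)

(* Defs.v *)
From HB Require Import structures.
From mathcomp Require Import all_boot all_order all_algebra finmap.
From mathcomp Require Import all_classical all_reals all_analysis.

Set Implicit Arguments.
Unset Strict Implicit.
Unset Printing Implicit Defensive.

Import Order.TTheory GRing.Theory Num.Theory.

Local Open Scope classical_set_scope.

Section Groups.
Variable G : groupType.
Implicit Types (K S : set G) (g h : G).
Local Open Scope group_scope.

Definition is_subgroup K := K 1 /\ forall g h, K g -> K h -> K (g / h).

Definition subgroup_gen S : set G := smallest is_subgroup S.

Definition generates S := subgroup_gen S = [set: G].

Definition word_in S (n : nat) g := exists w : seq G,
  [/\ size w = n, (forall s, s \in w -> S s \/ S s^-1) & g = \prod_(s <- w) s].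

(* The value 0 for elements outside the subgroup generated by S is junk. *)
Definition word_length S g : nat :=
  xget 0%N [set n | word_in S n g /\ forall m, word_in S m g -> (n <= m)%N].

(* Left-invariant, as is the action of G on itself by left multiplication. *)
Definition word_dist S g h : nat := word_length S (g^-1 * h).

End Groups.

(* The Foelner condition, for left translations. *)
Definition amenable (R : realType) (G : groupType) :=
  forall (K : {fset G}) (e : R), (0 < e)%R ->
  exists2 F : {fset G}, F != fset0 &
    forall k, k \in K ->
      let kF := [fset (k * g)%g | g in F]%fset in
      ((#|` (kF `\` F) `|` (F `\` kF)|%fset)%:R <= e * (#|` F|)%:R)%R.

Section IsoperimetricProfile.
Variables (R : realType) (G : groupType).
Implicit Types (p x : R) (S : {fset G}) (f : G -> R).
Local Open Scope ring_scope.

(* Both sums are only meant for finitely supported f, where they have finitely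
   many nonzero terms. *)
Definition lp_norm p f : R := (\sum_(g \in [set: G]) `|f g| `^ p) `^ p^-1.

Definition lp_grad_norm p S f : R :=
  (\sum_(g \in [set: G]) \sum_(s <- S) `|f g - f (g * s)%g| `^ p) `^ p^-1.

Definition supp f : set G := [set g | f g != 0].

Definition profile_fun x : set (G -> R) := [set f |
  [/\ forall g, 0 <= f g, exists g, f g != 0, finite_set (supp f) &
      (#|` fset_set (supp f)|)%:R <= x]].

(* The quotient is +oo when the gradient vanishes, which happens only if G is
   finite. *)
Definition iso_profile p S x : \bar R :=
  ereal_sup [set ((lp_norm p f)%:E / (lp_grad_norm p S f)%:E)%E |
             f in profile_fun x].

End IsoperimetricProfile.

(* A halo of groups over H; A is the group L(H), of which all the L(S) are
   subgroups. *)
Record halo (H A : groupType) := Halo {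
  halo_set :> set H -> set A;
  halo_subgroup : forall S, is_subgroup (halo_set S);
  haloS : forall R S, R `<=` S -> halo_set R `<=` halo_set S;
  halo0 : halo_set set0 = [set 1%g];
  haloT : halo_set setT = setT;
  halo_finite_gen :
    subgroup_gen (\bigcup_(S in [set S | finite_set S]) halo_set S) = setT;
  haloI : forall R S, halo_set (R `&` S) = halo_set R `&` halo_set S
}.

(* A morphism H -> Aut(L(H)): each halo_act h is an endomorphism, and it is
   bijective by halo_act1 and halo_actM. *)
Record halo_action (H A : groupType) (L : halo H A) := HaloAction {
  halo_act :> H -> A -> A;
  halo_act_morph : forall h, {morph halo_act h : a b / (a * b)%g};
  halo_act1 : forall a, halo_act 1%g a = a;
  halo_actM : forall g h a, halo_act (g * h)%g a = halo_act g (halo_act h a);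
  halo_act_set : forall h S,
    halo_act h @` L S = L [set (h * s)%g | s in S]
}.

Section HaloProduct.
Variables (H A : groupType) (L : halo H A) (alpha : halo_action L).
Local Open Scope group_scope.

Definition halo_product of halo_action L : Type := (A * H)%type.
Local Notation LH := (halo_product alpha).

HB.instance Definition _ := Choice.on LH.

Definition hp_one : LH := (1, 1).
Definition hp_mul (u v : LH) : LH := (u.1 * alpha u.2 v.1, u.2 * v.2).
Definition hp_inv (u : LH) : LH := (alpha u.2^-1 u.1^-1, u.2^-1).

Lemma halo_act_1 h : alpha h 1 = 1.
Proof.
apply: (mulgI (alpha h 1)); by rewrite -halo_act_morph !mulg1.
Qed.

Lemma hp_mulA : associative hp_mul.
Proof.
by move=> u v w; rewrite /hp_mul /= halo_act_morph halo_actM !mulgA.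
Qed.

Lemma hp_mul1 : left_id hp_one hp_mul.
Proof. by case=> a h; rewrite /hp_mul /= halo_act1 !mul1g. Qed.

Lemma hp_mulr1 : right_id hp_one hp_mul.
Proof. by case=> a h; rewrite /hp_mul /= halo_act_1 !mulg1. Qed.

Lemma hp_mulV : left_inverse hp_one hp_inv hp_mul.
Proof.
case=> a h; rewrite /hp_mul /= -halo_act_morph !mulVg halo_act_1 //.
Qed.

Lemma hp_mulrV : right_inverse hp_one hp_inv hp_mul.
Proof.
by case=> a h; rewrite /hp_mul /= -halo_actM !mulgV halo_act1 mulgV.
Qed.

HB.instance Definition _ :=
  isGroup.Build LH hp_mulA hp_mul1 hp_mulr1 hp_mulV hp_mulrV.

Definition naturally_generated (SH : {fset H}) :=
  @generates LH ([set ((1, s) : LH) | s in [set` SH]] `|`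
    \bigcup_(s in [set` SH])
      [set ((a, 1) : LH) | a in L [set t | t = 1 \/ t = s]]).

End HaloProduct.

Section HaloProperties.
Variables (H A : groupType) (L : halo H A).

Definition large_scale_commutative (SH : {fset H}) :=
  exists D : nat, forall R S : set H,
    (forall r s, R r -> S s -> (D <= word_dist [set` SH] r s)%N) ->
    forall a b, L R a -> L S b -> commute a b.

Definition consistent_blocks :=
  (forall S : {fset H}, finite_set (L [set` S])) /\
  (forall S T : {fset H}, #|` S|%fset = #|` T|%fset ->
    #|` fset_set (L [set` S])|%fset = #|` fset_set (L [set` T])|%fset).

(* When H is finite and n > |H|, there is no such S and the value is 0. *)
Definition lamp_growth (n : nat) : nat :=
  xget 0%N [set #|` fset_set (L [set` S])|%fset |
            S in [set S : {fset H} | #|` S|%fset = n]].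

Lemma lamp_growthE (S : {fset H}) : consistent_blocks ->
  lamp_growth #|` S|%fset = #|` fset_set (L [set` S])|%fset.
Proof.
move=> [_ cb]; rewrite /lamp_growth; case: xgetP => [n _ [T /= /cb <- <-]//|].
by move=> /(_ #|` fset_set (L [set` S])|%fset) [] /=; exists S.
Qed.

Definition halo_phi (n : nat) : nat := (n * lamp_growth n)%N.

End HaloProperties.

(* The generalised inverse of an increasing function on the natural numbers: the
   largest n such that phi n <= x. *)
Definition gen_inv (R : realType) (phi : nat -> nat) (x : R) : R :=
  sup [set n%:R | n in [set n | (phi n)%:R <= x]]%R.

(* Main.v *)
(** Lower bound: a function [f] on [H] with support [S] lifts to
    [(a, h) |-> f h] on [L(S) x H], extended by [0]. Moving by a generator takes
    [a] out of [L(S)] only at the cost of a jump of [f] at the boundary of [S],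
    so the lift has the same ratio as [f] up to constants, and its support has
    [|S| * |L(S)|] elements.

    Upper bound: [u = f ^ p] and its level sets reduce the claim to finite
    [U] in the halo product with [|U| <= x]. Cut [U] into fibres [U_a] in [H]. If [U]
    had too small a boundary, most of its points would lie in fibres larger than
    [C ln x], since smaller ones have a large boundary in [H]; and for most of
    these points [(a, h)], changing the lamp at [h] would stay in [U]. The set of
    such [a] would then have average degree of order [C ln x] in the graph
    [a -- a * alpha h sigma], hence more than [x] elements: halving along cosets
    of the groups [L (~` block h)] shows that the minimal degree of a finite
    set is at most logarithmic in its size. *)
Require Import Defs.
From mathcomp Require Import all_boot all_order all_algebra finmap.
From mathcomp Require Import all_classical all_reals all_analysis.
From mathcomp Require Import ring lra zify.

Set Implicit Arguments.
Unset Strict Implicit.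
Unset Printing Implicit Defensive.

Import Order.TTheory GRing.Theory Num.Theory.
Local Open Scope classical_set_scope.
Local Open Scope ring_scope.

(** * Finitely supported sums *)

Section FiniteSums.
Variables (R : realType) (T : choiceType).
Implicit Types (f g : T -> R) (F : {fset T}).

(** A sum over an infinite support has the default value 0, hence the finiteness hypotheses
    throughout. *)
Lemma fsumE F f : (forall x, f x != 0 -> x \in F) ->
  \sum_(x \in [set: T]) f x = \sum_(x <- F) f x.
Proof.
move=> fF; rewrite [RHS]fsbig_seq ?fset_uniq//; apply/esym/fsbig_widen => //.
by move=> x [_ /= xF]; apply/eqP; apply: contra_notT xF => /fF.
Qed.

Lemma finite_suppP f : finite_set [set x | f x != 0] ->
  exists F, forall x, f x != 0 -> x \in F.
Proof.
by move=> ff; exists (fset_set [set x | f x != 0]) => x fx; rewrite in_fset_set ?inE.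
Qed.

Lemma sub_supp f g : (forall x, g x = 0 -> f x = 0) ->
  finite_set [set x | g x != 0] -> finite_set [set x | f x != 0].
Proof.
move=> gf; apply: sub_finite_set => x /=; apply: contra_neq; exact: gf.
Qed.

Lemma ler_fsum f g : finite_set [set x | f x != 0] ->
  finite_set [set x | g x != 0] -> (forall x, f x <= g x) ->
  \sum_(x \in [set: T]) f x <= \sum_(x \in [set: T]) g x.
Proof.
move=> /finite_suppP[F fF] /finite_suppP[F' fF'] fg.
rewrite !(@fsumE (F `|` F')%fset) => [|x /fF'|x /fF].
- exact: ler_sum.
- by rewrite inE orbC => ->.
- by rewrite inE => ->.
Qed.

Lemma fsumD f g : finite_set [set x | f x != 0] ->
  finite_set [set x | g x != 0] ->
  \sum_(x \in [set: T]) (f x + g x) =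
  \sum_(x \in [set: T]) f x + \sum_(x \in [set: T]) g x.
Proof.
move=> /finite_suppP[F fF] /finite_suppP[F' fF'].
rewrite !(@fsumE (F `|` F')%fset) ?big_split// => x.
- by move=> /fF'; rewrite inE orbC => ->.
- by move=> /fF; rewrite inE => ->.
- apply: contraNT; rewrite inE negb_or => /andP[xF xF'].
  rewrite (eqP (contraNT (@fF x) xF)) (eqP (contraNT (@fF' x) xF')).
  by rewrite addr0.
Qed.

Lemma finite_suppD f g : finite_set [set x | f x != 0] ->
  finite_set [set x | g x != 0] -> finite_set [set x | f x + g x != 0].
Proof.
move=> ff fg; apply: sub_finite_set (_ : finite_set ([set x | f x != 0] `|`
  [set x | g x != 0])); last by rewrite finite_setU; split.
move=> x /=; have [->|] := eqVneq (f x) 0; last by left.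
by rewrite add0r; right.
Qed.

Lemma finite_suppZ a f : finite_set [set x | f x != 0] ->
  finite_set [set x | a * f x != 0].
Proof. by apply: sub_supp => x ->; rewrite mulr0. Qed.

Lemma finite_supp_sum (I : eqType) (r : seq I) (f : I -> T -> R) :
  (forall i, i \in r -> finite_set [set x | f i x != 0]) ->
  finite_set [set x | \sum_(i <- r) f i x != 0].
Proof.
elim: r => [_|i r IH fr].
  by apply: sub_finite_set (@finite_set0 T) => x /=; rewrite big_nil eqxx.
under eq_set do rewrite big_cons.
by apply: finite_suppD; [|apply: IH => j jr]; apply: fr; rewrite inE ?eqxx ?jr ?orbT.
Qed.

Lemma fsum_sum (I : eqType) (r : seq I) (f : I -> T -> R) :
  (forall i, i \in r -> finite_set [set x | f i x != 0]) ->
  \sum_(x \in [set: T]) \sum_(i <- r) f i x =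
  \sum_(i <- r) \sum_(x \in [set: T]) f i x.
Proof.
elim: r => [_|i r IH fr].
  by rewrite big_nil fsbig1// => x _; rewrite big_nil.
have fr' : forall j, j \in r -> finite_set [set x | f j x != 0].
  by move=> j jr; apply: fr; rewrite inE jr orbT.
have /fr fi : i \in i :: r by rewrite inE eqxx.
rewrite big_cons -IH// -fsumD//; last exact: finite_supp_sum.
by apply: eq_fsbigr => x _; rewrite big_cons.
Qed.

Lemma ler_sum_fsum (r : seq T) f : uniq r -> (forall x, 0 <= f x) ->
  finite_set [set x | f x != 0] ->
  \sum_(x <- r) f x <= \sum_(x \in [set: T]) f x.
Proof.
move=> ur f0 /finite_suppP[F fF].
rewrite (@fsumE ([fset x | x in r] `|` F)%fset); last first.
  by move=> x /fF xF; rewrite inE xF orbT.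
rewrite [leRHS](bigID (fun x => x \in r))/= ler_wpDr ?sumr_ge0//.
rewrite -[leRHS]big_filter; rewrite le_eqVlt; apply/orP; left; apply/eqP.
apply: perm_big; apply: uniq_perm => //; first exact/filter_uniq/fset_uniq.
by move=> x; rewrite mem_filter !inE; case: (x \in r).
Qed.

End FiniteSums.

(** * Gradients *)

Section ShiftVariation.
Variables (R : realType) (G : groupType).
Implicit Types (f : G -> R) (S : {fset G}) (p : R).

Lemma fsum_shift (a : G) (f : G -> R) :
  \sum_(g \in [set: G]) f g = \sum_(g \in [set: G]) f (g * a)%g.
Proof.
apply: (reindex_fsbigT (fun x : G => x * a)%g).
by exists (fun x => x * a^-1)%g => x; rewrite ?mulgK ?mulgVK.
Qed.

Lemma finite_supp_shift (a : G) f : finite_set [set g | f g != 0] ->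
  finite_set [set g | f (g * a)%g != 0].
Proof.
move=> ff; apply: sub_finite_set (finite_image (fun x => x * a^-1)%g ff) => g /= fg.
by exists (g * a)%g; rewrite ?mulgK.
Qed.

(** The share of one direction in the gradient, as a [p]-th power. It makes sense for every [a], so
    that generating sets can be compared. *)
Definition pvar p (a : G) f : R :=
  \sum_(g \in [set: G]) `|f g - f (g * a)%g| `^ p.

Lemma finite_supp_pvar p a f : 0 < p -> finite_set (supp f) ->
  finite_set [set g | `|f g - f (g * a)%g| `^ p != 0].
Proof.
move=> p0 ff.
apply: (@sub_finite_set _ _ (supp f `|` [set g | f (g * a)%g != 0])); last first.
  by rewrite finite_setU; split => //; exact: finite_supp_shift.
move=> g /=; have [fg|fg _] := eqVneq (f g) 0; last by left.
rewrite fg sub0r normrN => fga; right.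
by apply: contra_neq fga => ->; rewrite normr0 powR0// gt_eqF.
Qed.

Lemma pvar_ge0 p a f : 0 <= pvar p a f.
Proof. by apply: fsumr_ge0 => g _; exact: powR_ge0. Qed.

Definition gradient p S f : R := \sum_(s <- S) pvar p s f.

Lemma gradient_ge0 p S f : 0 <= gradient p S f.
Proof. by apply: sumr_ge0 => s _; exact: pvar_ge0. Qed.

Lemma lp_grad_normE p S f : 0 < p -> finite_set (supp f) ->
  lp_grad_norm p S f = gradient p S f `^ p^-1.
Proof.
move=> p0 ff; rewrite /lp_grad_norm; congr (_ `^ _).
by rewrite fsum_sum// => s _; exact: finite_supp_pvar.
Qed.

Lemma pvarV p a f : pvar p a^-1%g f = pvar p a f.
Proof.
rewrite /pvar [LHS](fsum_shift a).
by apply: eq_fsbigr => g _; rewrite mulgK distrC.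
Qed.

(** Bound [u + v] by twice the larger of the two. *)
Lemma powRD_le (p u v : R) : 0 <= p -> 0 <= u -> 0 <= v ->
  (u + v) `^ p <= 2 `^ p * (u `^ p + v `^ p).
Proof.
move=> p0; wlog uv : u v / u <= v => [H u0 v0|u0 v0].
  have [uv|/ltW uv] := leP u v; first exact: H.
  by rewrite addrC [X in _ * X]addrC; exact: H.
rewrite (@le_trans _ _ ((2 * v) `^ p))//.
  by rewrite ge0_ler_powR ?nnegrE ?addr_ge0 ?mulr_ge0// mulr_natl mulr2n lerD2r.
by rewrite powRM// ler_wpM2l ?powR_ge0// lerDr powR_ge0.
Qed.

(** Go from [g] to [g * a], then to [g * a * b]; the sum of the second increments is reindexed by
    the shift by [a]. *)
Lemma pvarM p a b f : 0 < p -> finite_set (supp f) ->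
  pvar p (a * b)%g f <= 2 `^ p * (pvar p a f + pvar p b f).
Proof.
move=> p0 ff; have fs := finite_supp_pvar _ p0 ff.
rewrite {3}/pvar (fsum_shift a) -fsumD//; last exact: (finite_supp_shift _ (fs b)).
rewrite mulr_fsumr; apply: ler_fsum => // [|g].
  exact/finite_suppZ/finite_suppD/(finite_supp_shift _ (fs b)).
apply: (le_trans _ (powRD_le (ltW p0) (normr_ge0 _) (normr_ge0 _))).
by rewrite ge0_ler_powR ?nnegrE ?addr_ge0 ?(ltW p0)// mulgA ler_distD.
Qed.

(** The elements [a] that admit such a constant form a subgroup, which contains [S]. *)
Lemma pvar_le_gradient p S : 0 < p -> generates [set` S] -> forall a,
  exists2 K, 0 <= K & forall f, finite_set (supp f) ->
    pvar p a f <= K * gradient p S f.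
Proof.
move=> p0 genS.
pose P a := exists2 K, 0 <= K & forall f, finite_set (supp f) ->
    pvar p a f <= K * gradient p S f.
suff : [set: G] `<=` [set a | P a] by move=> PT a; exact: PT.
rewrite -genS; apply: smallest_sub.
  split=> [|a b [K K0 aK] [K' K'0 bK']].
    exists 0 => // f ff; rewrite mul0r /pvar fsbig1// => g _.
    by rewrite mulg1 subrr normr0 powR0 ?gt_eqF.
  exists (2 `^ p * (K + K')) => [|f ff].
    by rewrite mulr_ge0 ?addr_ge0 ?powR_ge0.
  rewrite (le_trans (pvarM _ _ _ _))// -mulrA ler_wpM2l ?powR_ge0//.
  by rewrite mulrDl pvarV lerD //; [exact: aK|exact: bK'].
move=> s /= sS; exists 1 => // f ff; rewrite mul1r /gradient.
rewrite (big_fsetD1 s)//= lerDl.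
by apply: sumr_ge0 => t _; exact: pvar_ge0.
Qed.

End ShiftVariation.

(** * From [l^1] to [l^p] inequalities *)

Section PowerInequalities.
Variable R : realType.
Implicit Types p a b e t : R.

Lemma onem_expr_le t n : 0 <= t <= 1 -> 1 - t ^+ n <= n%:R * (1 - t).
Proof.
move=> /andP[t0 t1]; elim: n => [|n IH]; first by rewrite expr0 subrr mul0r.
have -> : 1 - t ^+ n.+1 = (1 - t ^+ n) + (1 - t) * t ^+ n.
  by rewrite exprS mulrBl mul1r addrA subrK.
rewrite -natr1 [leRHS]mulrDl mul1r lerD// ler_piMr ?subr_ge0//.
by rewrite exprn_ile1.
Qed.

Lemma powR_pred p a : 1 <= p -> 0 < a -> a * a `^ (p - 1) = a `^ p.
Proof.
move=> p1 a0; rewrite -[X in X * _]powRr1 ?ltW// -powRD ?subrKC//.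
by apply/implyP => _; rewrite gt_eqF.
Qed.

(** A mean value inequality without derivatives: for [t = b / a] and an integer [n > p],
    [1 - t ^ p <= 1 - t ^ n <= n (1 - t)]. *)
Lemma powRB_le p : 1 <= p -> exists2 c, 0 < c & forall a b, 0 <= b -> b <= a ->
  0 < a -> a `^ p - b `^ p <= c * ((a - b) * a `^ (p - 1)).
Proof.
move=> p1; have p0 : 0 < p by exact: lt_le_trans p1.
have /archi_boundP := ltW p0; set n := Num.bound p => pn.
exists n%:R => [|a b b0 ba a0]; first exact: lt_trans pn.
pose t := b / a; have t0 : 0 <= t by rewrite divr_ge0 ?(ltW a0).
have t1 : t <= 1 by rewrite ler_pdivrMr// mul1r.
have -> : b = t * a by rewrite /t divfK// gt_eqF.
rewrite powRM ?(ltW a0)// -{1}[a `^ p]mul1r -mulrBl -{2}[a]mul1r -mulrBl -mulrA.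
rewrite powR_pred// mulrA ler_wpM2r ?powR_ge0//.
apply: le_trans (onem_expr_le n (_ : 0 <= t <= 1)); last by rewrite t0 t1.
rewrite lerD2l lerN2 -powR_mulrn//; move: t0; rewrite le_eqVlt => /orP[/eqP <-|t0].
  by rewrite powR0 ?powR_ge0// gt_eqF// (lt_trans p0).
by apply: ger_powR; rewrite ?t0 ?t1// ltW.
Qed.

(** Young's inequality with a parameter: the second term dominates if [a <= e * b], the first one
    otherwise. *)
Lemma mul_powR_le p e a b : 1 <= p -> 0 < e -> 0 <= a -> 0 < b ->
  a * b `^ (p - 1) <= e `^ (1 - p) * a `^ p + e * b `^ p.
Proof.
move=> p1 e0 a0 b0; have [aeb|/ltW eba] := leP a (e * b).
  rewrite ler_wpDl ?mulr_ge0 ?powR_ge0//.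
  by rewrite -(powR_pred p1 b0) mulrA ler_wpM2r ?powR_ge0.
have {}a0 : 0 < a by rewrite (lt_le_trans _ eba)// mulr_gt0.
rewrite ler_wpDr ?mulr_ge0 ?powR_ge0 ?(ltW e0)//.
rewrite -(powR_pred p1 a0) mulrCA ler_wpM2l ?(ltW a0)//.
have eb0 : 0 <= e * b by rewrite mulr_ge0 ?ltW.
rewrite -[1 - p]opprB powRN ler_pdivlMl ?powR_gt0// -powRM ?(ltW e0) ?(ltW b0)//.
by rewrite ge0_ler_powR ?nnegrE ?subr_ge0 ?(ltW a0).
Qed.

(** The free parameter [e] will be taken small, so that the terms without a difference can be
    absorbed. *)
Lemma dist_powR_le p : 1 <= p -> exists2 c, 0 < c & forall e a b,
  0 < e -> 0 <= a -> 0 <= b ->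
  `|a `^ p - b `^ p| <= c * (e `^ (1 - p) * `|a - b| `^ p + e * (a `^ p + b `^ p)).
Proof.
move=> p1; have [c c0 H] := powRB_le p1; exists c => // e a b e0.
have p0 : 0 < p by exact: lt_le_trans p1.
wlog ba : a b / b <= a => [W a0 b0|a0 b0].
  have [ba|/ltW ab] := leP b a; first exact: W.
  by rewrite distrC (distrC a) (addrC (a `^ p)) W.
rewrite !ger0_norm ?subr_ge0// ?ge0_ler_powR ?nnegrE ?(ltW p0)//.
move: a0; rewrite le_eqVlt => /orP[/eqP a0|a0].
  have /eqP -> : b == 0 by rewrite eq_le b0 andbT a0.
  rewrite -a0 !subrr powR0 ?gt_eqF//.
  by rewrite mulr0 !add0r !mulr0.
rewrite (le_trans (H _ _ _ _ _))// ler_wpM2l ?(ltW c0)//.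
rewrite (le_trans (mul_powR_le p1 e0 _ _)) ?subr_ge0//.
by rewrite lerD2l ler_wpM2l ?(ltW e0)// lerDl powR_ge0.
Qed.

End PowerInequalities.

Section ReductionToL1.
Variables (R : realType) (G : groupType).
Implicit Types (f : G -> R) (S : {fset G}) (p : R).

Lemma gradient_powR_le p S : 1 <= p -> exists2 c, 0 < c & forall e f, 0 < e ->
  (forall g, 0 <= f g) -> finite_set (supp f) ->
  gradient 1 S (fun g => f g `^ p) <= c * (e `^ (1 - p) * gradient p S f +
    e * (#|` S|%:R *+ 2 * \sum_(g \in [set: G]) f g `^ p)).
Proof.
move=> p1; have [c c0 H] := dist_powR_le p1; exists c => // e f e0 f0 ff.
have p0 : 0 < p by exact: lt_le_trans p1.
have fu : finite_set [set g | f g `^ p != 0].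
  by apply: sub_supp ff => g ->; rewrite powR0 ?gt_eqF.
have sumE s : \sum_(g \in [set: G]) (f g `^ p + f (g * s)%g `^ p) =
    (\sum_(g \in [set: G]) f g `^ p) *+ 2.
  rewrite [LHS]fsumD//; last exact: (finite_supp_shift _ fu).
  by rewrite mulr2n; congr (_ + _); rewrite [RHS](fsum_shift s).
have -> : #|` S|%:R *+ 2 * \sum_(g \in [set: G]) f g `^ p =
    \sum_(s <- S) \sum_(g \in [set: G]) (f g `^ p + f (g * s)%g `^ p).
  rewrite (eq_bigr _ (fun s _ => sumE s)) big_const_seq count_predT iter_addr addr0.
  by rewrite mulrnAl -mulrnAr mulr_natl.
rewrite /gradient !mulr_sumr -big_split/= mulr_sumr; apply: ler_sum => s _.
have fs : finite_set [set g | f (g * s)%g `^ p != 0].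
  exact: (finite_supp_shift _ fu).
have fv := finite_supp_pvar s p0 ff.
rewrite !mulr_fsumr -fsumD ?mulr_fsumr; try exact/finite_suppZ/finite_suppD;
  try exact: finite_suppZ.
apply: ler_fsum => [||g].
- exact: finite_supp_pvar.
- exact/finite_suppZ/finite_suppD/finite_suppZ/finite_suppD/fs/fu/finite_suppZ/fv.
- by rewrite powRr1//; exact: H.
Qed.

(** The constant is the [p]-th power of a multiple of [K], so that after taking roots the [l^p]
    constant is linear in the [l^1] constant. *)
Lemma l1_to_lp p S : 1 <= p -> exists2 C, 0 < C & forall (K : R) f, 0 < K ->
  (forall g, 0 <= f g) -> finite_set (supp f) ->
  \sum_(g \in [set: G]) f g `^ p <= K * gradient 1 S (fun g => f g `^ p) ->
  \sum_(g \in [set: G]) f g `^ p <= (C * K) `^ p * gradient p S f.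
Proof.
move=> p1; have [c c0 H] := gradient_powR_le S p1.
(* [e = M^-1] makes the term in [u] of [gradient_powR_le] at most [u / 2]. *)
exists (4 * c * #|` S|.+1%:R) => [|K f K0 f0 ff]; first by rewrite !mulr_gt0.
set u := \sum_(g \in _) _; set M := 4 * c * _ * K => uK.
have M0 : 0 < M by rewrite !mulr_gt0.
have u0 : 0 <= u by apply: fsumr_ge0 => g _; exact: powR_ge0.
have {H} := H M^-1 f _ f0 ff; rewrite invr_gt0 => /(_ M0).
rewrite -(ler_pM2l K0) => /(le_trans uK); rewrite -/u.
rewrite -powR_inv1 ?(ltW M0)// -powRrM mulN1r opprB => uH.
have half : K * (c * (M `^ (-1) * (#|` S|%:R *+ 2 * u))) <= u / 2.
  rewrite powR_inv1 ?(ltW M0)// ler_pdivlMr//.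
  have -> : K * (c * (M^-1 * (#|` S|%:R *+ 2 * u))) * 2 =
      (4 * c * #|` S|%:R * K) / M * u by ring.
  rewrite -[leRHS]mul1r ler_wpM2r// ler_pdivrMr// mul1r ler_wpM2r ?(ltW K0)//.
  by rewrite ler_wpM2l ?ler_nat// mulr_ge0// ltW.
have {uH} : u / 2 <= K * c * M `^ (p - 1) * gradient p S f.
  rewrite -(lerD2r (u / 2)) -splitr (le_trans uH)// !mulrDr.
  by rewrite !mulrA in half *; rewrite lerD2l.
rewrite ler_pdivrMr// => /le_trans; apply.
rewrite -(powR_pred p1 M0) mulrAC ler_wpM2r ?gradient_ge0//.
rewrite mulrAC ler_wpM2r ?powR_ge0//.
have -> : K * c * 2 = 2 * c * 1 * K by ring.
rewrite ler_wpM2r ?(ltW K0)// ler_pM ?mulr_ge0 ?(ltW c0)//; last by rewrite ler1n.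
by rewrite ler_wpM2r ?(ltW c0)// ler_nat.
Qed.

End ReductionToL1.

(** * From finite sets to functions, by level sets *)

Section LevelSets.
Variables (R : realType) (G : groupType).
Implicit Types (S U F : {fset G}) (u : G -> R).

Definition indf U (g : G) : R := (g \in U)%:R.

Lemma supp_indf U : supp (indf U) = [set` U].
Proof.
by apply/seteqP; split => g; rewrite /supp/indf/=; case: (g \in U); rewrite ?oner_eq0 ?eqxx.
Qed.

Lemma finite_supp_indf U : finite_set (supp (indf U)).
Proof. by rewrite supp_indf; exact: finite_fset. Qed.

Lemma fsum_indf U : \sum_(g \in [set: G]) indf U g = #|` U|%:R.
Proof.
rewrite (@fsumE _ _ U) => [|g]; last by rewrite /indf; case: (g \in U); rewrite ?eqxx.
rewrite big_seq_cond (eq_bigr (fun=> 1)) => [|g]; last by rewrite andbT /indf => ->.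
by rewrite -big_seq_cond big_const_seq count_predT iter_addr addr0.
Qed.

(* Subtract from [u] its least positive value times the indicator function of its
   support: sums and gradients are additive along this decomposition. *)
Lemma sets_to_l1 S (x K : R) : 0 <= K ->
  (forall U, U != fset0 -> #|` U|%:R <= x ->
    #|` U|%:R <= K * gradient 1 S (indf U)) ->
  forall u F, (forall g, 0 <= u g) -> (forall g, (u g != 0) = (g \in F)) ->
    #|` F|%:R <= x ->
    \sum_(g \in [set: G]) u g <= K * gradient 1 S u.
Proof.
move=> K0 KU u F; move En: #|` F| => n; rewrite -En; move: En.
elim/ltn_ind: n F u => n IH F u Fn u0 uF Fx.
have fu : finite_set (supp u).
  by apply: sub_finite_set (finite_fset F) => g; rewrite /supp/= uF.
have [F0|/fset0Pn[g1 g1F]] := eqVneq F fset0.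
  rewrite fsbig1 ?mulr_ge0 ?gradient_ge0// => g _; apply/eqP.
  by apply/negPn; rewrite uF F0.
case: (@arg_minP _ _ _ [` g1F]%fset xpredT (fun i : F => u (val i))) => // g0 _ gmin.
set m := u (val g0) in gmin.
have m0 : 0 < m by rewrite lt_neqAle eq_sym uF (valP g0) u0.
have mu g : g \in F -> m <= u g by move=> gF; exact: (gmin [` gF]%fset).
pose u' g := u g - m * indf F g.
have u'0 g : 0 <= u' g.
  rewrite /u'/indf; case: (boolP (g \in F)) => [/mu|_]; first by rewrite mulr1 subr_ge0.
  by rewrite mulr0 subr0.
pose F' := [fset g in F | u g != m]%fset.
have u'F' g : (u' g != 0) = (g \in F').
  rewrite /u'/indf !inE/=; case: (boolP (g \in F)) => [gF|]; rewrite ?mulr1 ?subr_eq0//.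
  by rewrite -uF negbK => /eqP ->; rewrite mulr0 eqxx.
(* The minimiser [g0] drops out of the support, so the induction applies to [u']. *)
have F'F : (#|` F'| < n)%N.
  rewrite -Fn (cardfsD1 (val g0) F) (valP g0) add1n ltnS.
  apply/fsubset_leq_card/fsubsetP => g; rewrite !inE/= => /andP[gF gm].
  by rewrite gF andbT; apply: contra_neq gm => ->.
have fu' : finite_set (supp u').
  by apply: sub_finite_set (finite_fset F') => g; rewrite /supp/= u'F'.
have fF := finite_supp_indf F.
have usplit : \sum_(g \in [set: G]) u g =
    m * #|` F|%:R + \sum_(g \in [set: G]) u' g.
  rewrite -fsum_indf mulr_fsumr -[RHS]fsumD//; last exact: finite_suppZ.
  by apply: eq_fsbigr => g _; rewrite /u' addrC subrK.
(* No cancellation occurs: on an edge that leaves [F], the jump of [u] is its value inside, which is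
   [m] plus the nonnegative value of [u']. *)
have gsplit : gradient 1 S u = m * gradient 1 S (indf F) + gradient 1 S u'.
  rewrite /gradient mulr_sumr -big_split/=; apply: eq_bigr => s _.
  rewrite /pvar mulr_fsumr -[RHS]fsumD//; last 2 first.
  - by apply: finite_suppZ; exact: finite_supp_pvar.
  - exact: finite_supp_pvar.
  apply: eq_fsbigr => g _; rewrite !powRr1// /u' /indf.
  have z h : h \notin F -> u h = 0 by rewrite -uF negbK => /eqP.
  case: (boolP (g \in F)) => gF; case: (boolP (g * s \in F)%g) => gsF.
  - by rewrite subrr normr0 mulr0 add0r mulr1 opprB addrA subrK.
  - rewrite (z _ gsF) mulr0 mulr1 subrr !subr0 normr1 mulr1 !ger0_norm ?u0 ?subr_ge0 ?mu//.
    by rewrite addrC subrK.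
  - rewrite (z _ gF) mulr0 mulr1 subrr !sub0r !normrN normr1 mulr1 !ger0_norm ?u0 ?subr_ge0 ?mu//.
    by rewrite addrC subrK.
  - by rewrite (z _ gF) (z _ gsF) mulr0 !subrr normr0 mulr0 addr0.
rewrite usplit gsplit mulrDr lerD//; last first.
  apply: (IH _ F'F F') => //; rewrite (le_trans _ Fx)// ler_nat.
  by rewrite ltnW// Fn.
rewrite mulrCA ler_wpM2l ?(ltW m0)// KU//.
by apply/fset0Pn; exists g1.
Qed.

End LevelSets.

(** * Growth of finite sets of large degree *)

Lemma card_fimage_in (T T' : choiceType) (f : T -> T') (F : {fset T}) :
  {in F &, injective f} -> #|` [fset f x | x in F]%fset| = #|` F|.
Proof. by move=> fF; apply/eqP/card_in_imfsetP. Qed.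

Lemma card_fimage_le (T T' : choiceType) (f : T -> T') (F : {fset T}) :
  (#|` [fset f x | x in F]%fset| <= #|` F|)%N.
Proof. exact: leq_imfset_card. Qed.

Section MinimalDegree.
Variables (A : groupType) (H : choiceType) (sigma : H -> A).
Implicit Types (V : {fset A}) (E : {fset A * H}) (W : {fset H}).

(** A degree condition in the graph with edges [a -- a * sigma h]. Labels are counted rather than
    neighbours, and edges may be followed both ways. *)
Definition has_labels V a d := exists2 W : {fset H}, (d <= #|` W|)%N &
  forall h, h \in W -> (a * sigma h)%g \in V \/ (a * (sigma h)^-1)%g \in V.

(* Elements with fewer than [d] labels are discarded one at a time: each removal
   deletes fewer than [2 d] edges. *)
Lemma min_degree_subset V E d :
  (forall e, e \in E -> e.1 \in V /\ (e.1 * sigma e.2)%g \in V) ->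
  V != fset0 -> (2 * d * #|` V| <= #|` E|)%N ->
  exists V', [/\ (V' `<=` V)%fset, V' != fset0 &
    forall a, a \in V' -> has_labels V' a d].
Proof.
move En : #|` V| => n; elim/ltn_ind: n V E En => n IH V E Vn EV V0 dE.
have [good|] := pselect (forall a, a \in V -> has_labels V a d).
  by exists V; split.
move=> /existsNP[a /not_implyP[aV bad]].
have fewer W : (forall h, h \in W ->
    (a * sigma h)%g \in V \/ (a * (sigma h)^-1)%g \in V) -> (#|` W| < d)%N.
  by move=> Wa; rewrite ltnNge; apply/negP => dW; apply: bad; exists W.
(* Edges out of [a], and below those into [a]. Within each family an edge is determined by its
   label, so each has fewer than [d] members. *)
pose E1 := [fset e in E | e.1 == a]%fset.
pose E2 := [fset e in E | (e.1 * sigma e.2)%g == a]%fset.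
have E1d : (#|` E1| < d)%N.
  rewrite -(@card_fimage_in _ _ snd); last first.
    by move=> [b h] [b' h'] /=; rewrite !inE/= => /andP[_ /eqP ->] /andP[_ /eqP ->] ->.
  apply: fewer => h /imfsetP[[b h'] /=]; rewrite !inE/= => /andP[eE /eqP ba] ->.
  by left; rewrite -ba; case: (EV _ eE).
have E2d : (#|` E2| < d)%N.
  rewrite -(@card_fimage_in _ _ snd); last first.
    move=> [b h] [b' h'] /=; rewrite !inE/= => /andP[_ /eqP <-] /andP[_ /eqP] + hh.
    by rewrite hh => /mulIg ->.
  apply: fewer => h /imfsetP[[b h'] /=]; rewrite !inE/= => /andP[eE /eqP ba] ->.
  by right; rewrite -ba mulgK; case: (EV _ eE).
pose E' := [fset e in E | (e.1 != a) && ((e.1 * sigma e.2)%g != a)]%fset.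
have EE' : (#|` E| <= #|` E'| + (#|` E1| + #|` E2|))%N.
  apply: (@leq_trans #|` (E' `|` (E1 `|` E2))%fset|).
    apply/fsubset_leq_card/fsubsetP => e eE; rewrite !inE/= eE/=.
    by case: eqP => //= _; case: eqP => //= _; rewrite orbT.
  rewrite (leq_trans (leq_card_fsetU _ _))// leq_add2l.
  exact: leq_card_fsetU.
have Vc : n = #|` (V `\ a)%fset|.+1 by rewrite -Vn (cardfsD1 a) aV.
have E'V e : e \in E' ->
    e.1 \in (V `\ a)%fset /\ (e.1 * sigma e.2)%g \in (V `\ a)%fset.
  by rewrite !inE/= => /andP[/EV[-> ->] /andP[-> ->]].
(* The inequality is strict because both removed families have fewer than [d] edges; thus [E'] is
   nonempty, and so is [V] without [a]. *)
have dE' : (2 * d * #|` (V `\ a)%fset| < #|` E'|)%N by nia.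
have V'0 : (V `\ a)%fset != fset0.
  have /fset0Pn[e /E'V[eV _]] : E' != fset0.
    by rewrite -cardfs_gt0; exact: leq_ltn_trans dE'.
  by apply/fset0Pn; exists e.1.
have [|V' [V'V V'n V'd]] := IH _ _ _ _ erefl E'V V'0 (ltnW dE').
  by rewrite Vc.
exists V'; split => //; rewrite (fsubset_trans V'V)//; exact: fsubD1set.
Qed.

End MinimalDegree.

Section HaloGrowth.
Variables (H A : groupType) (L : halo H A).

Lemma haloV S a : L S a -> L S a^-1%g.
Proof.
have [L1 LD] := halo_subgroup L S; move=> La.
by rewrite -[a^-1%g]mul1g; exact: LD.
Qed.

Lemma haloM S a b : L S a -> L S b -> L S (a * b)%g.
Proof.
have [_ LD] := halo_subgroup L S; move=> La Lb.
by rewrite -[b]invgK; apply: LD => //; exact: haloV.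
Qed.

Lemma halo1 S : L S 1%g.
Proof. by case: (halo_subgroup L S). Qed.

Lemma halo_disjoint S T a : S `&` T = set0 -> L S a -> L T a -> a = 1%g.
Proof.
move=> ST LS LT; have : (L S `&` L T) a by split.
by rewrite -haloI ST halo0.
Qed.

Variables (B : {fset H}) (sigma : H -> A).
Hypothesis sigmaL : forall h, L [set (h * s)%g | s in [set` B]] (sigma h).
Hypothesis sigma1 : forall h, sigma h <> 1%g.

Let block h := [set (h * s)%g | s in [set` B]].

(** The blocks of [h] and [h'] meet exactly when [h'] lies in [h * diff_fset], so the size of this
    set bounds the number of labels that interfere with a given one. *)
Definition diff_fset : {fset H} := [fset (x * y^-1)%g | x in B, y in B]%fset.

(* Keep the labels [h'] whose block misses that of [h]: [sigma h'] then lies in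
   [L (~` block h)], which does not contain [sigma h]. So [V] meets two distinct
   left cosets of this subgroup, and each part loses few labels. *)
Lemma card_min_degree V k : V != fset0 ->
  (forall a, a \in V -> has_labels sigma V a (k * #|` diff_fset|.+1)) ->
  (2 ^ k <= #|` V|)%N.
Proof.
elim: k V => [|k IH] V V0 Vd; first by rewrite expn0 cardfs_gt0.
have /fset0Pn[a aV] := V0.
have [W Wk Wa] := Vd _ aV.
(* The [.+1] in the required degree makes it positive here. *)
have /fset0Pn[h hW] : W != fset0 by rewrite -cardfs_gt0; apply: leq_trans Wk.
pose Q := L (~` block h).
have sQ : ~ Q (sigma h).
  move=> Qs; apply: (sigma1 (h := h)).
  by apply: halo_disjoint (sigmaL h) Qs; rewrite setICr.
have [a' a'V aa'] : exists2 a', a' \in V & ~ Q (a^-1 * a')%g.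
  case: (Wa _ hW) => aV'; [exists (a * sigma h)%g|exists (a * (sigma h)^-1)%g] => //.
    by rewrite mulKg.
  by rewrite mulKg => /haloV; rewrite invgK.
pose C b := [fset c in V | `[< Q (b^-1 * c)%g >]]%fset.
have CP b c : reflect (c \in V /\ Q (b^-1 * c)%g) (c \in C b).
  by rewrite !inE/=; apply: (iffP andP) => -[? /asboolP].
have C2k b : b \in V -> (2 ^ k <= #|` C b|)%N.
  move=> bV; apply: IH => [|c /CP[cV Qc]].
    by apply/fset0Pn; exists b; apply/CP; rewrite mulVg; split => //; exact: halo1.
  have [Y Yk Yc] := Vd _ cV.
  (* [I] contains every label whose block meets that of [h]. Removing it costs at most
     [#|diff_fset|] labels, less than the drop from [k.+1] to [k] allows. *)
  pose I := [fset (h * d)%g | d in diff_fset]%fset; pose Y' := (Y `\` I)%fset.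
  exists Y' => [|h'].
    have : (#|` I| <= #|` diff_fset|)%N by exact: card_fimage_le.
    have := fsubset_leq_card (fsubsetIr Y I); rewrite /Y' cardfsD.
    move: Yk; rewrite mulSn.
    by move: #|` _|%N #|` _|%N #|` _|%N #|` _|%N => *; lia.
  move=> /fsetDP[h'Y h'n].
  have Qh' : Q (sigma h').
    apply: haloS (sigmaL h') => _ [s sB <-] [t tB hts].
    move/negP: h'n; apply; apply/imfsetP; exists (t * s^-1)%g => /=.
      by apply/imfset2P; exists t => //; exists s.
    by rewrite mulgA hts mulgK.
  case: (Yc _ h'Y) => cs; [left|right]; apply/CP; split => //; rewrite mulgA.
    exact: haloM.
  by apply: haloM => //; exact: haloV.
have : (#|` (C a `|` C a')%fset| <= #|` V|)%N.
  by apply/fsubset_leq_card; rewrite fsubUset; apply/andP; split; apply/fsubsetP => c /CP[].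
apply: leq_trans; rewrite cardfsU (_ : C a `&` C a' = fset0)%fset; last first.
  apply/fsetP => c; rewrite in_fsetI in_fset0; apply/negP => /andP[/CP[_ Qa] /CP[_ Qa']].
  apply: aa'; have := haloM Qa (haloV Qa').
  by rewrite invgM invgK !mulgA mulgK.
by rewrite cardfs0 subn0 expnS mul2n -addnn leq_add// C2k.
Qed.

End HaloGrowth.

(** * Isoperimetry of finite subsets of the halo product *)

Section PairSums.
Variables (R : realType) (T T' : choiceType).
Implicit Types (f : T * T' -> R) (V : {fset T}).

Lemma perm_fsetM V (W : {fset T'}) :
  perm_eq (V `*` W)%fset [seq (a, h) | a <- V, h <- W].
Proof.
apply: uniq_perm.
- exact: fset_uniq.
- apply: allpairs_uniq_dep => [|a _|]; [exact: fset_uniq|exact: fset_uniq|].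
  by move=> -[a h] [a' h'] _ _ [-> ->].
case=> a h; rewrite in_fsetM; apply/andP/allpairsP => /=.
  by move=> [aV hW]; exists (a, h).
by move=> [[b h'] /= [bV hW [-> ->]]].
Qed.

Lemma cardfsM V (W : {fset T'}) : #|` (V `*` W)%fset| = (#|` V| * #|` W|)%N.
Proof. by rewrite (perm_size (perm_fsetM V W)) size_allpairs. Qed.

Lemma fsum_pair V f : finite_set [set x | f x != 0] ->
  (forall x, f x != 0 -> x.1 \in V) ->
  \sum_(x \in [set: T * T']) f x = \sum_(a <- V) \sum_(h \in [set: T']) f (a, h).
Proof.
move=> /finite_suppP[F fF] fV; pose W := [fset x.2 | x in F]%fset.
have fW a h : f (a, h) != 0 -> h \in W.
  by move=> /fF ahF; apply/imfsetP; exists (a, h).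
rewrite (@fsumE _ _ (V `*` W)%fset) => [|[a h] fah]; last first.
  by rewrite in_fsetM (fV _ fah) (fW _ _ fah).
under [RHS]eq_bigr => a _ do rewrite (@fsumE _ _ W _ (fW a)).
by rewrite (perm_big _ (perm_fsetM V W))/= big_allpairs_dep.
Qed.

Lemma ler_fsum_pair V f : finite_set [set x | f x != 0] -> (forall x, 0 <= f x) ->
  \sum_(a <- V) \sum_(h \in [set: T']) f (a, h) <= \sum_(x \in [set: T * T']) f x.
Proof.
move=> ff f0; pose g x := (x.1 \in V)%:R * f x.
have fg : finite_set [set x | g x != 0].
  by apply: sub_supp ff => x fx; rewrite /g fx mulr0.
apply: (@le_trans _ _ (\sum_(x \in [set: T * T']) g x)).
  rewrite (@fsum_pair V g) => // [|x]; last by rewrite /g; case: (_ \in V); rewrite ?mul0r ?eqxx.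
  rewrite big_seq [leRHS]big_seq; apply: ler_sum => a aV; rewrite le_eqVlt; apply/orP; left.
  by apply/eqP/eq_fsbigr => h _; rewrite /g aV mul1r.
apply: ler_fsum => // x; rewrite /g; case: (_ \in V); first by rewrite mul1r.
by rewrite mul0r.
Qed.

End PairSums.

Section Fibres.
Variables (R : realType) (T T' : choiceType) (U : {fset T * T'}).

Definition fibre a : {fset T'} := [fset x.2 | x in [fset x in U | x.1 == a]]%fset.

Lemma in_fibre a h : (h \in fibre a) = ((a, h) \in U).
Proof.
apply/imfsetP/idP => [[[b h'] /=]|ahU]; last first.
  by exists (a, h) => //; rewrite !inE/= ahU eqxx.
by rewrite !inE/= => /andP[+ /eqP <-] ->.
Qed.

(** As [P] looks only at the first coordinate, [W] is a disjoint union of whole fibres. *)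
Lemma card_fibres (P : pred T) (W := [fset x in U | P x.1]%fset) :
  #|` W| = (\sum_(a <- [fset x.1 | x in W]%fset) #|` fibre a|)%N.
Proof.
pose pairs := flatten [seq [seq (a, h) | h <- fibre a] | a <- [fset x.1 | x in W]%fset].
have : perm_eq W pairs.
  apply: uniq_perm => //.
    rewrite allpairs_uniq_dep//= => -[a h] [a' h'] _ _ [-> ->] //.
  case=> a h; apply/idP/allpairsPdep => [ahW|[b [h' [/imfsetP[[c k] /= cW ->]]]]].
    exists a, h; split => //; first by apply/imfsetP; exists (a, h).
    by rewrite in_fibre; move: ahW; rewrite !inE/= => /andP[].
  rewrite in_fibre => cU [-> ->]; move: cW; rewrite !inE/= cU.
  by move=> /andP[].
move=> /perm_size; rewrite size_flatten /shape -map_comp sumnE big_map => ->.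
by apply: eq_bigr => a _ /=; rewrite size_map.
Qed.

End Fibres.

Section HaloFoelner.
Variables (R : realType) (H A : groupType) (L : halo H A) (alpha : halo_action L).
Notation LH := (halo_product alpha).
Variables (TH : {fset H}) (TL : {fset LH}) (sigma : A) (B : {fset H}).
Hypotheses (sigmaB : L [set` B] sigma) (sigma1 : sigma <> 1%g).

Lemma halo_mul_lamp (a : A) (h : H) (s : A) :
  (((a, h) : LH) * ((s, 1) : LH))%g = (a * alpha h s, h)%g.
Proof. by transitivity ((a * alpha h s, h * 1)%g : LH) => //; rewrite mulg1. Qed.

Lemma halo_mul_base (a : A) (h s : H) :
  (((a, h) : LH) * ((1, s) : LH))%g = (a, h * s)%g.
Proof.
by transitivity ((a * alpha h 1, h * s)%g : LH) => //; rewrite halo_act_1 mulg1.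
Qed.

Lemma halo_act_neq1 h : alpha h sigma <> 1%g.
Proof.
move=> h1; apply: sigma1; rewrite -(halo_act1 alpha sigma) -(mulVg h) halo_actM h1.
exact: halo_act_1.
Qed.

Lemma halo_act_block h : L [set (h * s)%g | s in [set` B]] (alpha h sigma).
Proof. by rewrite -(halo_act_set alpha); exists sigma. Qed.

Variables (K1 K2 : R).
Hypothesis base_le : forall f : LH -> R, finite_set (supp f) ->
  \sum_(s <- TH) pvar 1 ((1%g, s) : LH) f <= K1 * gradient 1 TL f.
Hypothesis lamp_le : forall f : LH -> R, finite_set (supp f) ->
  pvar 1 ((sigma, 1%g) : LH) f <= K2 * gradient 1 TL f.

Variables (J N : R) (k : nat).
Hypothesis J0 : 0 <= J.
Hypothesis isoH : forall V : {fset H}, V != fset0 -> #|` V|%:R <= N ->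
  #|` V|%:R <= J * gradient 1 TH (indf R V).
Hypothesis kN : (4 * k * #|` diff_fset B|.+1)%:R <= N.

Variable U : {fset LH}.
Let large a := N < #|` fibre U a|%:R.
Let Ularge := [fset x in U | large x.1]%fset.
Let Usmall := [fset x in U | ~~ large x.1]%fset.
Let lamp : LH := (sigma, 1%g).
Let d := gradient 1 TL (indf R U).

(** Small fibres obey the isoperimetric inequality of [H]. Base generators preserve the first
    coordinate, so the boundaries of the fibres add up within the boundary of [U]. *)
Lemma card_small_fibres : #|` Usmall|%:R <= J * K1 * d.
Proof.
rewrite (card_fibres U (fun a => ~~ large a)) natr_sum.
set V := imfset _ _ _.
have VP a : a \in V -> fibre U a != fset0 /\ #|` fibre U a|%:R <= N.
  move=> /imfsetP[[b h] /=]; rewrite !inE/= -leNgt => /andP[bhU bN] ->; split => //.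
  by apply/fset0Pn; exists h; rewrite in_fibre.
apply: (@le_trans _ _ (\sum_(a <- V) J * gradient 1 TH (indf R (fibre U a)))).
  by rewrite big_seq [leRHS]big_seq; apply: ler_sum => a /VP[]; exact: isoH.
rewrite -mulr_sumr -mulrA ler_wpM2l//.
apply: le_trans (base_le (finite_supp_indf R U)).
rewrite exchange_big/=; apply: ler_sum => s _.
have fv := finite_supp_pvar ((1%g, s) : LH) (ltr01 : 0 < 1 :> R) (finite_supp_indf R U).
apply: le_trans (ler_fsum_pair V fv _) => [|x]; last exact: powR_ge0.
apply: ler_sum => a _; rewrite le_eqVlt; apply/orP; left; apply/eqP.
by apply: eq_fsbigr => h _; rewrite halo_mul_base /indf !in_fibre.
Qed.

Lemma card_lamp_boundary : #|` [fset x in U | (x * lamp)%g \notin U]%fset|%:R <= K2 * d.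
Proof.
apply: le_trans (lamp_le (finite_supp_indf R U)); set D := imfset _ _ _.
have fv := finite_supp_pvar lamp (ltr01 : 0 < 1 :> R) (finite_supp_indf R U).
apply: le_trans (ler_sum_fsum (fset_uniq D) _ fv) => [|x]; last exact: powR_ge0.
rewrite big_seq (eq_bigr (fun=> 1)) => [|x].
  by rewrite -big_seq big_const_seq count_predT iter_addr addr0.
rewrite !inE/= /indf => /andP[-> /negbTE ->].
by rewrite subr0 normr1 powR1.
Qed.

(** If the bound failed, [2 * #|Usmall| + #|D|] would be less than half of [#|U|], hence
    [2 * #|E| > #|U| >= N * #|V|]. By [kN] this is the edge density required by [min_degree_subset],
    and the resulting set has at least [2 ^ k] elements, too many for [U]. *)
Lemma card_le_gradient : U != fset0 -> (#|` U| < 2 ^ k)%N ->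
  #|` U|%:R <= (4 * J * K1 + 2 * K2) * d.
Proof.
move=> U0 Uk; rewrite leNgt; apply/negP => dU.
pose E := [fset x in Ularge | (x * lamp)%g \in Ularge]%fset.
pose D := [fset x in U | (x * lamp)%g \notin U]%fset.
(* A point of [U] outside [E] is in a small fibre, leaves [U] under [lamp], or is sent by [lamp]
   into a small fibre. *)
have UE : (#|` U| <= #|` E| + (#|` Usmall| + (#|` D| + #|` Usmall|)))%N.
  pose I := [fset (x * lamp^-1)%g | x in Usmall]%fset.
  apply: (@leq_trans #|` (E `|` (Usmall `|` (D `|` I)))%fset|).
    apply/fsubset_leq_card/fsubsetP => x xU.
    have xI : (x * lamp)%g \in Usmall -> x \in I.
      by move=> xs; apply/imfsetP; exists (x * lamp)%g; rewrite ?mulgK.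
    rewrite !in_fsetU; move: xI; rewrite !inE/= xU/=.
    case: (boolP (large x.1)) => //= _; case: (_ \in U) => //=.
    by case: (large _) => //= ->; rewrite ?orbT.
  do 3!rewrite (leq_trans (leq_card_fsetU _ _))// leq_add2l.
  exact: card_fimage_le.
have UE' : #|` U|%:R < 2 * #|` E|%:R :> R.
  have := card_small_fibres; have := card_lamp_boundary; rewrite -/D.
  move: UE; rewrite -(ler_nat R) !natrD.
  by move: dU; rewrite mulrDl; nra.
pose V := [fset x.1 | x in Ularge]%fset.
have VN : N * #|` V|%:R <= #|` Ularge|%:R.
  rewrite (card_fibres U large) natr_sum -/V.
  rewrite mulr_natr -(addr0 (_ *+ _)) -iter_addr -count_predT -big_const_seq.
  rewrite big_seq [leRHS]big_seq; apply: ler_sum => a /imfsetP[x /=].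
  by rewrite !inE/= => /andP[_ /ltW] + ->.
have UU : (#|` Ularge| <= #|` U|)%N.
  by apply/fsubset_leq_card/fsubsetP => x; rewrite !inE => /andP[].
have VU : (#|` V| <= #|` U|)%N.
  exact: leq_trans (card_fimage_le _ _) UU.
have V0 : V != fset0.
  have : E != fset0.
    rewrite -cardfs_gt0 -(ltr_nat R) -(pmulr_rgt0 _ (ltr0n R 2)).
    by apply: le_lt_trans UE'.
  move=> /fset0Pn[x]; rewrite !inE/= => /andP[xU _].
  by apply/fset0Pn; exists x.1; apply/imfsetP; exists x; rewrite // !inE.
(* A point [(a, h)] of [E] is now read as the edge with label [h] from [a] to
   [a * alpha h sigma]. *)
have [||V' [V'V V'0 V'd]] := @min_degree_subset A H (fun h => alpha h sigma) V E
    (k * #|` diff_fset B|.+1) _ V0 _.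
- case=> a h; rewrite !inE/= => /andP[xU yU]; split.
    by apply/imfsetP; exists (a, h); rewrite // !inE.
  apply/imfsetP; exists (((a, h) : LH) * lamp)%g; last by rewrite halo_mul_lamp.
  by rewrite !inE.
- rewrite -(ler_nat R) -(ler_pM2l (ltr0n R 2)) ltW//; apply: le_lt_trans UE'.
  rewrite -natrM mulnA (_ : (2 * (2 * (k * _)) = 4 * k * #|` diff_fset B|.+1)%N); last by lia.
  rewrite natrM (le_trans _ (le_trans VN _)) ?ler_nat//.
  by rewrite ler_wpM2r.
have := card_min_degree halo_act_block halo_act_neq1 V'0 V'd.
by rewrite leqNgt (leq_ltn_trans _ Uk)// (leq_trans _ VU)// fsubset_leq_card.
Qed.

End HaloFoelner.

(** * Lifting functions to the halo product *)

Lemma pvar_seq_le_gradient (R : realType) (G : groupType) (p : R) (S : {fset G})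
    (r : seq G) : 0 < p -> generates [set` S] ->
  exists2 K, 0 <= K & forall f : G -> R, finite_set (supp f) ->
    \sum_(a <- r) pvar p a f <= K * gradient p S f.
Proof.
move=> p0 genS; elim: r => [|a r [K K0 rK]].
  by exists 0 => // f _; rewrite big_nil mul0r.
have [K' K'0 aK] := pvar_le_gradient p0 genS a.
exists (K' + K) => [|f ff]; first exact: addr_ge0.
by rewrite big_cons mulrDl lerD ?aK ?rK.
Qed.

(** Such elements form a subgroup, since two finite sets have a finite union, and [halo_finite_gen]
    makes it everything. *)
Lemma halo_finite_block (H A : groupType) (L : halo H A) (a : A) :
  exists W : {fset H}, L [set` W] a.
Proof.
suff : [set: A] `<=` [set a | exists W : {fset H}, L [set` W] a] by apply.
rewrite -(halo_finite_gen L); apply: smallest_sub.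
  split=> [|b c [W bW] [W' cW']]; first by exists fset0; exact: halo1.
  exists (W `|` W')%fset; apply: haloM.
    by apply: haloS bW => h /= hW; rewrite inE hW.
  by apply: haloV; apply: haloS cW' => h /= hW; rewrite inE hW orbT.
move=> b [S /= Sf bS]; exists (fset_set S).
by apply: haloS bS => h hS /=; rewrite in_fset_set// inE.
Qed.

Section Lift.
Variables (R : realType) (H A : groupType) (L : halo H A) (alpha : halo_action L).
Notation LH := (halo_product alpha).
Hypothesis Lfin : forall S : {fset H}, finite_set (L [set` S]).
Variables (S : {fset H}) (f : H -> R).
Hypothesis suppf : forall h, (f h != 0) = (h \in S).
Implicit Types p : R.

Let K := fset_set (L [set` S]).

Let inK a : reflect (L [set` S] a) (a \in K).
Proof. by rewrite in_fset_set//; apply: (iffP idP); rewrite inE. Qed.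

Definition lift_fun (z : LH) : R := (z.1 \in K)%:R * f z.2.

Lemma lift_fun_neq0 z : (lift_fun z != 0) = (z \in (K `*` S)%fset).
Proof.
case: z => a h; rewrite in_fsetM /lift_fun -suppf /= mulf_eq0 negb_or.
by case: (a \in K); rewrite ?oner_eq0 ?eqxx.
Qed.

Lemma finite_supp_lift : finite_set (supp lift_fun).
Proof.
apply: sub_finite_set (finite_fset (K `*` S)%fset) => z.
by rewrite /supp/= lift_fun_neq0.
Qed.

Lemma card_supp_lift : #|` fset_set (supp lift_fun)| = (#|` S| * #|` K|)%N.
Proof.
have -> : supp lift_fun = [set` (K `*` S)%fset].
  by apply/seteqP; split => z; rewrite /supp/= lift_fun_neq0.
by rewrite set_fsetK cardfsM mulnC.
Qed.

Lemma fsum_slab (psi : H -> R) : finite_set [set h | psi h != 0] ->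
  \sum_(z \in [set: LH]) ((z.1 \in K)%:R * psi z.2) =
  #|` K|%:R * \sum_(h \in [set: H]) psi h.
Proof.
move=> fpsi; rewrite (@fsum_pair _ _ _ K).
- rewrite big_seq (eq_bigr (fun=> \sum_(h \in [set: H]) psi h)) => [|a aK].
    by rewrite -big_seq big_const_seq count_predT iter_addr addr0 mulr_natl.
  by apply: eq_fsbigr => h _; rewrite /= aK mul1r.
- have [F fF] := finite_suppP fpsi.
  apply: sub_finite_set (finite_fset (K `*` F)%fset) => z /=.
  rewrite mulf_eq0 negb_or in_fsetM => /andP[zK /fF ->].
  by rewrite andbT; case: (_ \in K) zK; rewrite ?eqxx.
- by move=> z; case: (z.1 \in K); rewrite // mul0r eqxx.
Qed.

Lemma fsum_lift p : 0 < p -> \sum_(z \in [set: LH]) `|lift_fun z| `^ p =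
  #|` K|%:R * \sum_(h \in [set: H]) `|f h| `^ p.
Proof.
move=> p0; rewrite -fsum_slab.
  apply: eq_fsbigr => z _; rewrite /lift_fun; case: (_ \in K); first by rewrite !mul1r.
  by rewrite !mul0r normr0 powR0// gt_eqF.
apply: sub_finite_set (finite_fset S) => h /=; rewrite -suppf.
by apply: contra_neq => ->; rewrite normr0 powR0// gt_eqF.
Qed.

Lemma halo_act_mem (W : {fset H}) (sigma : A) h : L [set` W] sigma ->
  (forall w, w \in W -> (h * w)%g \in S) -> L [set` S] (alpha h sigma).
Proof.
move=> sW hW.
have : L [set (h * s)%g | s in [set` W]] (alpha h sigma).
  by rewrite -(halo_act_set alpha); exists sigma.
by apply: haloS => _ [w wW <-]; exact: hW.
Qed.

(** A majorant for the variation of the lift along [(sigma, s)] with [sigma] in [L(W)]. Made of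
    differences of [f] only, it sums to something the gradient of [f] controls. *)
Definition jump p (W : {fset H}) (s h : H) : R :=
  `|f h - f (h * s)%g| `^ p + \sum_(w <- W)
    (`|f h - f (h * w)%g| `^ p + `|f (h * s)%g - f (h * w)%g| `^ p).

Lemma jump_ge0 p W s h : 0 <= jump p W s h.
Proof.
by rewrite addr_ge0 ?powR_ge0//; apply: sumr_ge0 => w _; rewrite addr_ge0 ?powR_ge0.
Qed.

(* If some translate [h * w] leaves [S] then [f (h * w) = 0], which pays for a
   change of the lamp indicator; otherwise this indicator does not change. *)
Lemma dist_lift_le (W : {fset H}) p a h sigma s : 0 < p -> L [set` W] sigma ->
  `|lift_fun (a, h) - lift_fun (a * alpha h sigma, h * s)%g| `^ p <=
  (a \in K)%:R * jump p W s h + ((a * alpha h sigma)%g \in K)%:R * jump p W s h.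
Proof.
move=> p0 sW; set psi := jump p W s h; rewrite /lift_fun/=.
have psi0 : 0 <= psi by exact: jump_ge0.
case: (pselect (forall w, w \in W -> (h * w)%g \in S)) => [hW|].
  have asK := halo_act_mem sW hW.
  have -> : ((a * alpha h sigma)%g \in K) = (a \in K).
    apply/inK/inK => [aK|aK]; last exact: haloM.
    by rewrite -(mulgK (alpha h sigma) a); apply: haloM aK (haloV asK).
  case: (a \in K); last by rewrite !mul0r subrr normr0 powR0 ?addr0// gt_eqF.
  have psi1 : `|f h - f (h * s)%g| `^ p <= psi.
    by rewrite /psi/jump lerDl; apply: sumr_ge0 => w _; rewrite addr_ge0 ?powR_ge0.
  by rewrite !mul1r (le_trans psi1)// lerDl.
move=> /existsNP[w /not_implyP[wW /negP hwS]].
have fhw : f (h * w)%g = 0 by apply/eqP; rewrite -[_ == _]negbK suppf.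
have [psi1 psi2 psi3] : [/\ `|f h - f (h * s)%g| `^ p <= psi, `|f h| `^ p <= psi &
    `|f (h * s)%g| `^ p <= psi].
  have big0 : 0 <= \sum_(v <- (W `\ w)%fset)
     (`|f h - f (h * v)%g| `^ p + `|f (h * s)%g - f (h * v)%g| `^ p).
    by apply: sumr_ge0 => v _; rewrite addr_ge0 ?powR_ge0.
  rewrite /psi/jump (big_fsetD1 w)//= fhw !subr0.
  have := powR_ge0 `|f h - f (h * s)%g| p; have := powR_ge0 `|f h| p.
  have := powR_ge0 `|f (h * s)%g| p; move: big0.
  by move: (`|f h| `^ p) (`|_| `^ p) (`|_| `^ p) (\sum_(_ <- _) _) => *; split; lra.
case: (a \in K); case: (_ \in K); rewrite ?mul1r ?mul0r ?subr0 ?sub0r ?normrN ?addr0 ?add0r//.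
  by rewrite (le_trans psi1)// lerDl.
by rewrite normr0 powR0 ?gt_eqF.
Qed.

Let finf : finite_set (supp f).
Proof. by apply: sub_finite_set (finite_fset S) => h; rewrite /supp/= suppf. Qed.

Let jump_term s w h : f (h * w)%g = f (h * s * (s^-1 * w))%g.
Proof. by rewrite mulgA mulgK. Qed.

Let finite_supp_jump_term p s w : 0 < p ->
  finite_set [set h | `|f (h * s)%g - f (h * w)%g| `^ p != 0].
Proof.
move=> p0; under eq_set do rewrite (jump_term s w).
exact: (finite_supp_shift s (finite_supp_pvar (s^-1 * w)%g p0 finf)).
Qed.

Lemma finite_supp_jump p W s : 0 < p -> finite_set [set h | jump p W s h != 0].
Proof.
move=> p0; apply: finite_suppD; first exact: finite_supp_pvar.
apply: finite_supp_sum => w _; apply: finite_suppD; first exact: finite_supp_pvar.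
exact: finite_supp_jump_term.
Qed.

(** The displacement from [h * s] to [h * w] is [s^-1 * w], which explains the last part of the
    list. *)
Lemma fsum_jump p W s : 0 < p -> \sum_(h \in [set: H]) jump p W s h =
  \sum_(w <- (s :: W ++ [seq (s^-1 * w)%g | w <- W])) pvar p w f.
Proof.
move=> p0; rewrite fsumD; first last.
- apply: finite_supp_sum => w _; apply: finite_suppD; first exact: finite_supp_pvar.
  exact: finite_supp_jump_term.
- exact: finite_supp_pvar.
rewrite big_cons big_cat big_map/= -big_split/=; congr (_ + _).
rewrite fsum_sum => [|w _]; last first.
  by apply: finite_suppD; [exact: finite_supp_pvar|exact: finite_supp_jump_term].
apply: eq_bigr => w _; rewrite fsumD; first last.
- exact: finite_supp_jump_term.
- exact: finite_supp_pvar.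
congr (_ + _); rewrite /pvar [RHS](fsum_shift s).
by apply: eq_fsbigr => h _; rewrite (jump_term s w).
Qed.

Lemma pvar_lift_le (W : {fset H}) p sigma s : 0 < p -> L [set` W] sigma ->
  pvar p ((sigma, s) : LH) lift_fun <=
  2 * #|` K|%:R * \sum_(h \in [set: H]) jump p W s h.
Proof.
move=> p0 sW; have fj := finite_supp_jump W s p0.
pose g (z : LH) := (z.1 \in K)%:R * jump p W s z.2.
have fg : finite_set [set z | g z != 0].
  have [F fF] := finite_suppP fj.
  apply: sub_finite_set (finite_fset (K `*` F)%fset) => z /=.
  rewrite mulf_eq0 negb_or in_fsetM => /andP[zK /fF ->].
  by rewrite andbT; case: (_ \in K) zK; rewrite ?eqxx.
have fg' := finite_supp_shift ((sigma, 1%g) : LH) fg.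
(* The term with indicator of [a * alpha h sigma] is the translate of [g] by [(sigma, 1)] and has
   the same sum, whence the factor 2. *)
rewrite -mulrA -fsum_slab// mulr_natl mulr2n {2}(fsum_shift ((sigma, 1%g) : LH)).
rewrite -(fsumD fg fg'); apply: ler_fsum => [||[a h]].
- by apply: finite_supp_pvar => //; exact: finite_supp_lift.
- exact: (finite_suppD fg fg').
rewrite halo_mul_lamp/=; exact: dist_lift_le.
Qed.

End Lift.

(** Each lamp component in [TL] has a finite block [W] chosen before [S] and [f], which makes the
    constant uniform in them. *)
Lemma gradient_lift_le (R : realType) (H A : groupType) (L : halo H A)
    (alpha : halo_action L) (TH : {fset H}) (TL : seq (halo_product alpha)) (p : R) :
  (forall S : {fset H}, finite_set (L [set` S])) -> 0 < p -> generates [set` TH] ->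
  exists2 C, 0 <= C & forall (S : {fset H}) (f : H -> R),
    (forall h, (f h != 0) = (h \in S)) ->
    \sum_(t <- TL) pvar p t (lift_fun S f) <=
    C * #|` fset_set (L [set` S])|%:R * gradient p TH f.
Proof.
move=> Lfin p0 genTH; elim: TL => [|[sigma s] TL [C C0 TLC]].
  by exists 0 => // S f _; rewrite big_nil !mul0r.
have [W sW] := halo_finite_block L sigma.
have [C' C'0 sC'] := pvar_seq_le_gradient (s :: W ++ [seq (s^-1 * w)%g | w <- W]) p0 genTH.
exists (2 * C' + C) => [|S f Sf]; first by rewrite addr_ge0// mulr_ge0.
rewrite big_cons 2!mulrDl lerD ?TLC// (le_trans (pvar_lift_le alpha Lfin Sf s p0 sW))//.
have -> (k g : R) : 2 * C' * k * g = 2 * k * (C' * g) by ring.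
rewrite ler_wpM2l ?mulr_ge0// (fsum_jump Sf)// sC'//.
by apply: sub_finite_set (finite_fset S) => h; rewrite /supp/= Sf.
Qed.

(** * Isoperimetric profiles *)

Section Ratio.
Variable R : realType.

(** The product form covers zero denominators: the right side is [+oo] if [b' = 0], and [b = 0]
    forces [b' = 0]. *)
Lemma ratio_le (C a b a' b' : R) : 0 < C -> 0 < a -> 0 < a' -> 0 <= b -> 0 <= b' ->
  a * b' <= C * (a' * b) -> (a%:E / b%:E <= C%:E * (a'%:E / b'%:E))%E.
Proof.
move=> C0 a0 a'0 b0 b'0 abC; rewrite [in leRHS]inver.
case: eqP => [_|/eqP b'n0].
  by rewrite gt0_muley ?lte_fin// gt0_muley ?lte_fin// leey.
have {}b'0 : 0 < b' by rewrite lt_neqAle eq_sym b'n0.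
have {b0} bp : 0 < b.
  rewrite lt_neqAle b0 andbT eq_sym; apply/negP => /eqP bz.
  by move: abC; rewrite bz !mulr0 leNgt mulr_gt0.
rewrite inver gt_eqF// -!EFinM lee_fin mulrA ler_pdivrMr// mulrAC ler_pdivlMr//.
by rewrite -mulrA.
Qed.

Lemma iso_profile_ge (G : groupType) (p x : R) (S : {fset G}) f : profile_fun x f ->
  ((lp_norm p f)%:E / (lp_grad_norm p S f)%:E <= iso_profile p S x)%E.
Proof. by move=> fx; apply: ereal_sup_ubound; exists f. Qed.

Lemma profile_funP (G : groupType) (x : R) (f : G -> R) : profile_fun x f ->
  exists F : {fset G}, [/\ F != fset0, #|` F|%:R <= x &
    forall g, (f g != 0) = (g \in F)].
Proof.
case=> f0 [g fg] ff fx; exists (fset_set (supp f)); split => //.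
  by apply/fset0Pn; exists g; rewrite in_fset_set// inE.
by move=> h; rewrite in_fset_set//; apply/idP/idP; rewrite inE.
Qed.

Lemma lp_norm_gt0 (G : groupType) (p x : R) (f : G -> R) : 0 < p ->
  profile_fun x f -> 0 < lp_norm p f.
Proof.
move=> p0 fx; have [F [/fset0Pn[g gF] _ fF]] := profile_funP fx.
have fn : `|f g| `^ p > 0 by rewrite powR_gt0// normr_gt0 fF.
rewrite powR_gt0//; apply: lt_le_trans fn _.
rewrite (@fsumE _ _ F) => [|h]; last first.
  by rewrite -fF; apply: contra_neq => ->; rewrite normr0 powR0// gt_eqF.
by rewrite (big_fsetD1 g)//= lerDl; apply: sumr_ge0 => h _; exact: powR_ge0.
Qed.

End Ratio.

(** * Lamp growth and the generalised inverse *)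

Section LampGrowth.
Variables (H A : groupType) (L : halo H A).
Hypothesis blocks : consistent_blocks L.

Lemma fset_extend n (S : {fset H}) : infinite_set [set: H] -> (#|` S| <= n)%N ->
  exists2 T : {fset H}, (S `<=` T)%fset & #|` T| = n.
Proof.
move=> infH; elim: n => [|n IH].
  by rewrite leqn0 => /eqP S0; exists S.
rewrite leq_eqVlt => /orP[/eqP Sn|/IH[T ST Tn]]; first by exists S.
have [x xT] : exists x, x \notin T.
  apply/not_existsP => allT; apply: infH; apply: sub_finite_set (finite_fset T) => x _.
  by apply/negPn/negP => xT; exact: (allT x).
exists (x |` T)%fset; last by rewrite cardfsU1 xT Tn.
exact: fsubset_trans (fsubsetUr _ _).
Qed.

(** Over a finite [H], monotonicity would break at [#|H|], after which [lamp_growth] takes its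
    default value 0. *)
Lemma lamp_growth_le m n : infinite_set [set: H] -> (m <= n)%N ->
  (lamp_growth L m <= lamp_growth L n)%N.
Proof.
move=> infH mn.
have [S _ Sm] := @fset_extend m fset0 infH (leq0n _).
rewrite -Sm in mn *; have [T ST <-] := fset_extend infH mn.
rewrite !lamp_growthE//; apply/fsubset_leq_card/fsubsetP => a.
rewrite !in_fset_set ?inE; [|exact: blocks.1|exact: blocks.1].
by apply: haloS => h /= hS; exact: (fsubsetP ST).
Qed.

Lemma lamp_growth_finite n : finite_set [set: H] ->
  (#|` fset_set [set: H]| < n)%N -> lamp_growth L n = 0%N.
Proof.
move=> finH Hn; rewrite /lamp_growth; case: xgetP => // k _ [S /= Sn _].
move: Hn; rewrite -Sn ltnNge => /negP[]; apply/fsubset_leq_card/fsubsetP => h _.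
by rewrite in_fset_set// inE.
Qed.

(** [sup] is 0 on an empty or unbounded set, which [0 < m] rules out. So [H] is infinite, since
    otherwise [halo_phi] vanishes eventually and [E] is unbounded. Some [n] in the set exceeds the
    supremum minus 1, hence [m <= n]. *)
Lemma halo_phi_le_gen_inv (R : realType) m (x : R) : 0 <= x -> (0 < m)%N ->
  m%:R <= gen_inv (halo_phi L) x -> (halo_phi L m)%:R <= x.
Proof.
move=> x0 m0; rewrite /gen_inv; set E := [set _ | _ in _] => mE.
have supE : has_sup E.
  apply: contrapT => /sup_out E0; move: mE.
  by rewrite E0 leNgt ltr0n m0.
have infH : infinite_set [set: H].
  move=> finH; have [M EM] := supE.2.
  pose k := (Num.bound `|M| + #|` fset_set [set: H]|.+1)%N.
  have Ek : E k%:R.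
    exists k => //=; rewrite /halo_phi lamp_growth_finite ?muln0//.
    by rewrite /k addnS ltnS leq_addl.
  have := EM _ Ek; apply/negP; rewrite -ltNge.
  apply: (@lt_le_trans _ _ (Num.bound `|M|)%:R); last by rewrite ler_nat leq_addr.
  by rewrite (le_lt_trans (ler_norm M))// archi_boundP.
have [_ [n nx <-] nE] := sup_adherent (ltr01 : 0 < 1 :> R) supE.
have mn : (m <= n)%N.
  rewrite -ltnS -(ltr_nat R) -natr1 -ltrBlDr; apply: le_lt_trans nE.
  by rewrite lerD2r.
by apply: le_trans nx; rewrite ler_nat leq_mul// lamp_growth_le.
Qed.

End LampGrowth.

(** * The lower bound *)

Lemma iso_profile_lower (R : realType) (H A : groupType) (L : halo H A)
    (alpha : halo_action L) (TH : {fset H}) (TL : {fset halo_product alpha}) (p : R) :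
  consistent_blocks L -> generates [set` TH] -> 1 <= p ->
  exists2 C1, 1 <= C1 & forall C x : R, C1 <= C -> 0 <= x ->
    (C^-1%:E * iso_profile p TH (C^-1 * gen_inv (halo_phi L) x)
      <= iso_profile p TL x)%E.
Proof.
move=> blocks genTH p1; have p0 : 0 < p by exact: lt_le_trans p1.
have [C0 C00 lift_le] := gradient_lift_le TL blocks.1 p0 genTH.
(* The root of [C0] compares the gradient norms; the 1 ensures [C^-1 <= 1]. *)
exists (C0 `^ p^-1 + 1) => [|C x C1C x0]; first by rewrite lerDr powR_ge0.
have C1 : 1 <= C by rewrite (le_trans _ C1C)// lerDr powR_ge0.
have Cp : 0 < C by exact: lt_le_trans C1.
rewrite lee_pdivrMl//; apply: ge_ereal_sup => _ [f ffun <-].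
have [S [S0 Sx fS]] := profile_funP ffun.
have gi0 : 0 <= gen_inv (halo_phi L) x.
  have : 0 <= C^-1 * gen_inv (halo_phi L) x by exact: le_trans Sx.
  by rewrite pmulr_rge0// invr_gt0.
have {}Sx : (halo_phi L #|` S|)%:R <= x.
  apply: halo_phi_le_gen_inv => //; first by rewrite cardfs_gt0.
  by rewrite (le_trans Sx)// ler_piMl// invf_le1.
pose F : halo_product alpha -> R := lift_fun S f.
set K := fset_set (L [set` S]) in lift_le *.
have K0 : (0 < #|` K|)%N.
  rewrite cardfs_gt0; apply/fset0Pn; exists 1%g.
  by rewrite in_fset_set ?inE; [exact: halo1|exact: blocks.1].
have Ffun : profile_fun x F.
  split.
  - by move=> z; rewrite /F/lift_fun mulr_ge0//; case: ffun.
  - have /fset0Pn[h hS] := S0; exists (1%g, h); rewrite lift_fun_neq0//.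
    rewrite in_fsetM hS andbT in_fset_set ?inE; [exact: halo1|exact: blocks.1].
  - exact: finite_supp_lift.
  - rewrite card_supp_lift//; move: Sx; rewrite /halo_phi lamp_growthE//.
apply: le_trans (lee_wpmul2l _ (iso_profile_ge p TL Ffun)); last by rewrite lee_fin ltW.
apply: ratio_le => //; rewrite ?powR_ge0//.
- exact: lp_norm_gt0 ffun.
- exact: lp_norm_gt0 Ffun.
have ff : finite_set (supp f) by case: ffun.
have fF : finite_set (supp F) by case: Ffun.
(* Lifting multiplies the norm by the [p]-th root of [#|K|]; the same factor in the gradient bound
   cancels it. *)
rewrite !lp_grad_normE// /lp_norm fsum_lift// powRM ?fsumr_ge0//.
set n := (\sum_(h \in _) _) `^ _; set g := gradient p TH f.
have g0 : 0 <= g by exact: gradient_ge0.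
apply: (@le_trans _ _ (n * (C0 * #|` K|%:R * g) `^ p^-1)).
  rewrite ler_wpM2l ?powR_ge0// ge0_ler_powR ?nnegrE ?invr_ge0 ?(ltW p0) ?gradient_ge0//.
    by rewrite !mulr_ge0.
  exact: lift_le.
rewrite !powRM ?mulr_ge0//.
have -> : C * (#|` K|%:R `^ p^-1 * n * g `^ p^-1) =
  n * (C * #|` K|%:R `^ p^-1 * g `^ p^-1) by ring.
rewrite ler_wpM2l ?powR_ge0// -!mulrA ler_wpM2r ?mulr_ge0 ?powR_ge0//.
by rewrite (le_trans _ C1C)// lerDl.
Qed.

(** * The upper bound *)

Lemma indf_profile (R : realType) (G : groupType) (V : {fset G}) (x : R) :
  V != fset0 -> #|` V|%:R <= x -> profile_fun x (indf R V).
Proof.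
move=> /fset0Pn[g gV] Vx; split.
- by move=> h; rewrite /indf.
- by exists g; rewrite /indf gV oner_eq0.
- exact: finite_supp_indf.
- by rewrite supp_indf set_fsetK.
Qed.

(** Test the profile on an indicator function. A zero gradient would give the quotient [+oo], which
    a finite [J] excludes. *)
Lemma iso_profile1_card (R : realType) (G : groupType) (S V : {fset G}) (x J : R) :
  iso_profile 1 S x = J%:E -> V != fset0 -> #|` V|%:R <= x ->
  #|` V|%:R <= J * gradient 1 S (indf R V).
Proof.
move=> SJ V0 Vx; have := iso_profile_ge 1 S (indf_profile V0 Vx).
have fV := finite_supp_indf R V; have g0 := gradient_ge0 1 S (indf R V).
rewrite SJ lp_grad_normE// /lp_norm invr1 !powRr1//; last first.
  by apply: fsumr_ge0 => g _; exact: powR_ge0.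
rewrite (eq_fsbigr (indf R V)) => [|g _]; last by rewrite powRr1 ?ger0_norm /indf.
rewrite fsum_indf inver; case: eqP => [_|/eqP gn0].
  by rewrite gt0_muley ?lte_fin ?ltr0n ?cardfs_gt0// leye_eq.
by rewrite -EFinM lee_fin ler_pdivrMr// lt_neqAle eq_sym gn0.
Qed.

(** Since [ln x >= 1], [N / M] is at least [1 + ln x / ln 2], and the 1 compensates for the
    truncation. *)
Lemma lt_expn2_of_ln (R : realType) (x N M : R) : expR 1 <= x -> 0 < M ->
  M * (1 + (ln 2)^-1) * ln x <= N ->
  x < 2 ^+ Num.truncn (N / M).
Proof.
move=> x1 M0 xN; have ln2 : 0 < ln 2 :> R by rewrite ln_gt0// ltr1n.
have x0 : 0 < x by apply: lt_le_trans x1; exact: expR_gt0.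
have lnx : 1 <= ln x by rewrite -(expRK 1) ler_ln ?posrE ?expR_gt0.
rewrite -ltr_ln ?posrE ?exprn_gt0// lnXn// -(mulr_natr (ln 2)).
have NM : (1 + (ln 2)^-1) * ln x <= N / M by rewrite ler_pdivlMr// mulrC mulrA.
have := truncnS_gt (N / M).
rewrite -natr1; set k := (Num.truncn _)%:R; move=> kN.
have : (ln 2)^-1 * ln x < k by move: NM; rewrite mulrDl mul1r; lra.
by rewrite ltr_pdivrMl.
Qed.

Lemma powRrM_inv (R : realType) (a p : R) : 0 <= a -> 0 < p -> (a `^ p) `^ p^-1 = a.
Proof. by move=> a0 p0; rewrite -powRrM mulfV ?gt_eqF// powRr1. Qed.

(** Apply [sets_to_l1] to [f ^ p], which has the support of [f], then [l1_to_lp]. *)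
Lemma sets_to_lp (R : realType) (G : groupType) (S : {fset G}) (p : R) : 1 <= p ->
  exists2 C, 0 < C & forall x K : R, 0 < K ->
  (forall U : {fset G}, U != fset0 -> #|` U|%:R <= x ->
    #|` U|%:R <= K * gradient 1 S (indf R U)) ->
  forall f, profile_fun x f -> lp_norm p f <= C * K * lp_grad_norm p S f.
Proof.
move=> p1; have p0 : 0 < p by exact: lt_le_trans p1.
have [C C0 lp_le] := l1_to_lp S p1; exists C => // x K K0 setsG f ffun.
have [F [_ Fx fF]] := profile_funP ffun; have [f0 _ ff _] := ffun.
have fp0 g : 0 <= f g `^ p by exact: powR_ge0.
have Fp g : (f g `^ p != 0) = (g \in F) by rewrite -fF powR_eq0 (gt_eqF p0) andbT.
have := lp_le K f K0 f0 ff (sets_to_l1 (ltW K0) setsG fp0 Fp Fx).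
have -> : lp_norm p f = (\sum_(g \in [set: G]) f g `^ p) `^ p^-1.
  by congr (_ `^ _); apply: eq_fsbigr => g _; rewrite ger0_norm ?f0.
have u0 : 0 <= \sum_(g \in [set: G]) f g `^ p by apply: fsumr_ge0 => g _; exact: fp0.
rewrite (lp_grad_normE S p0 ff).
have := gradient_ge0 p S f; move: u0; clear -C0 K0 p0.
move: (\sum_(g \in _) _) (gradient _ _ _) => u g u0 g0 ug.
have CK0 : 0 <= C * K by rewrite mulr_ge0// ltW.
rewrite -[X in X * _](powRrM_inv CK0 p0) -powRM ?powR_ge0//.
by rewrite ge0_ler_powR ?nnegrE ?invr_ge0 ?(ltW p0) ?mulr_ge0 ?powR_ge0.
Qed.

Lemma iso_profile_upper (R : realType) (H A : groupType) (L : halo H A)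
    (alpha : halo_action L) (TH : {fset H}) (TL : {fset halo_product alpha}) (p : R) :
  (exists a : A, a <> 1%g) -> generates [set` TL] -> 1 <= p ->
  exists2 C1, 0 < C1 & forall C x : R, C1 <= C -> expR 1 <= x ->
    (iso_profile p TL x <= C%:E * iso_profile 1 TH (C * ln x))%E.
Proof.
move=> [sigma sigma1] genTL p1; have p0 : 0 < p by exact: lt_le_trans p1.
have [B sigmaB] := halo_finite_block L sigma.
have [K1 K10 base_le] := pvar_seq_le_gradient
  [seq ((1%g, s) : halo_product alpha) | s <- TH] (ltr01 : 0 < 1 :> R) genTL.
have [K2 K20 lamp_le] := pvar_le_gradient (ltr01 : 0 < 1 :> R) genTL
  ((sigma, 1%g) : halo_product alpha).
have [C0 C00 lp_le] := sets_to_lp TL p1.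
(* Testing on a point gives [J * g1 >= 1], so the term [2 * K2], which lacks the factor [J], is at
   most [2 * K2 * g1 * J]. This explains [K], whose 1 keeps it positive. *)
pose g1 := gradient 1 TH (indf R [fset 1%g]%fset).
have g10 : 0 <= g1 by exact: gradient_ge0.
pose M : R := (4 * #|` diff_fset B|.+1)%:R.
have M0 : 0 < M by rewrite ltr0n.
pose K := 4 * K1 + 2 * K2 * g1 + 1.
have K0 : 0 < K by rewrite ltr_wpDl// addr_ge0 ?mulr_ge0.
have ln2 : 0 < ln 2 :> R by rewrite ln_gt0// ltr1n.
have M'0 : 0 < M * (1 + (ln 2)^-1) by rewrite mulr_gt0// addr_gt0// invr_gt0.
(* The summands ensure in turn that a point is an admissible test set, that the final constant is at
   most [C], and that [2 ^ k] exceeds [x]. *)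
exists (1 + C0 * K + M * (1 + (ln 2)^-1)) => [|C x C1C x1].
  by rewrite !addr_gt0// mulr_gt0.
have C0K : 0 < C0 * K by rewrite mulr_gt0.
have lnx : 1 <= ln x by rewrite -(expRK 1) ler_ln ?posrE ?(lt_le_trans _ x1) ?expR_gt0.
have Cp : 1 <= C by lra.
have Clnx : 1 <= C * ln x by rewrite -[1]mulr1 ler_pM.
have one0 : [fset 1%g]%fset != fset0 :> {fset H} by apply/fset0Pn; exists 1%g; rewrite inE.
have one_le : #|` [fset (1 : H)%g]%fset|%:R <= C * ln x by rewrite cardfs1.
(* The claim is trivial if the profile of [H] is [+oo], and the test on a point excludes [-oo]. *)
case EJ: (iso_profile 1 TH (C * ln x)) => [J| |]; last 2 first.
- by rewrite gt0_muley ?lte_fin ?leey// (lt_le_trans _ Cp).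
- have := iso_profile_ge 1 TH (indf_profile one0 one_le).
  rewrite EJ leeNy_eq => /eqP E.
  have : (0 <= -oo :> \bar R)%E.
    by rewrite -E mule_ge0 ?inve_ge0 ?lee_fin ?powR_ge0.
  by [].
have J1 : 1 <= J * g1 by have := iso_profile1_card EJ one0 one_le; rewrite cardfs1.
have J0 : 0 < J.
  by rewrite ltNge; apply/negP => Jn; have := mulr_le0_ge0 Jn g10; lra.
(* The largest [k] satisfying [kN]. *)
pose k := Num.truncn (C * ln x / M).
have xk : x < (2 ^ k)%:R.
  rewrite natrX; apply: lt_expn2_of_ln => //.
  by rewrite ler_wpM2r ?(le_trans _ lnx)//; lra.
have kN : (4 * k * #|` diff_fset B|.+1)%:R <= C * ln x.
  rewrite mulnAC natrM -/M -ler_pdivlMl// mulrC truncn_le.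
  by rewrite divr_ge0 ?(ltW M0)// (le_trans _ Clnx).
have base_le' (f : halo_product alpha -> R) : finite_set (supp f) ->
    \sum_(s <- TH) pvar 1 ((1%g, s) : halo_product alpha) f <= K1 * gradient 1 TL f.
  by move=> /base_le; rewrite big_map.
have setsLH (U : {fset halo_product alpha}) : U != fset0 -> #|` U|%:R <= x ->
    #|` U|%:R <= K * J * gradient 1 TL (indf R U).
  move=> U0 Ux.
  have := card_le_gradient sigmaB sigma1 base_le' lamp_le (ltW J0)
    (fun V => iso_profile1_card EJ) kN U0.
  rewrite -(ltr_nat R) => /(_ (le_lt_trans Ux xk)) /le_trans; apply.
  rewrite ler_wpM2r ?gradient_ge0// /K.
  have -> : (4 * K1 + 2 * K2 * g1 + 1) * J = 4 * J * K1 + 2 * K2 * (J * g1) + J by ring.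
  by rewrite -[leLHS]addr0 lerD ?(ltW J0)// lerD2l ler_peMr// mulr_ge0.
apply: ge_ereal_sup => _ [f ffun <-].
have KJ0 : 0 < K * J by rewrite mulr_gt0.
have fg := lp_le x (K * J) KJ0 setsLH f ffun.
have f_gt0 := lp_norm_gt0 p0 ffun.
have grad_gt0 : 0 < lp_grad_norm p TL f.
  rewrite lt_neqAle eq_sym powR_ge0 andbT; apply/negP => /eqP gz.
  by move: fg; rewrite gz mulr0 leNgt f_gt0.
rewrite inver gt_eqF// -!EFinM lee_fin ler_pdivrMr// (le_trans fg)//.
rewrite ler_wpM2r ?powR_ge0// mulrA ler_wpM2r ?(ltW J0)//.
by rewrite (le_trans _ C1C)// addrAC lerDr addr_ge0// ltW.
Qed.

Theorem corollaryE (R : realType) (H A : groupType)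
    (L : halo H A) (alpha : halo_action L)
    (SH : {fset H}) (genSH : generates [set` SH])
    (amenH : amenable R H)
    (A_nontrivial : exists a : A, a <> 1%g)
    (natgen : naturally_generated alpha SH)
    (lscomm : large_scale_commutative L SH)
    (blocks : consistent_blocks L)
    (TH : {fset H}) (genTH : generates [set` TH])
    (TL : {fset halo_product alpha}) (genTL : generates [set` TL])
    (p : R) (p_ge1 : 1 <= p) :
  exists2 C : R, 0 < C &
    \forall x \near +oo,
      (C^-1%:E * iso_profile p TH (C^-1 * gen_inv (halo_phi L) x)
         <= iso_profile p TL x)%E /\
      (iso_profile p TL x <= C%:E * iso_profile 1 TH (C * ln x))%E.
Proof.
have [C1 C1_ge1 lower] := iso_profile_lower TL blocks genTH p_ge1.
have [C2 C2_gt0 upper] := iso_profile_upper TH A_nontrivial genTL p_ge1.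
(* Each bound holds for every constant above its threshold, so the sum serves both. *)
exists (C1 + C2); first by rewrite addr_gt0// (lt_le_trans _ C1_ge1).
near=> x.
have x1 : expR 1 <= x by near: x; apply: nbhs_pinfty_ge; rewrite num_real.
split.
  by apply: lower; rewrite ?lerDl ?(ltW C2_gt0)// (le_trans _ x1)// expR_ge0.
by apply: upper => //; rewrite lerDr (le_trans _ C1_ge1).
Unshelve. all: by end_near. Qed.
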